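(* Let $A\in\mathbb{R}^{k\times n}$ have full row rank, let $C\in\mathbb{R}^{m\times n}$ and $\boldsymbol{b}\in\mathbb{R}^k$. If the linear lexicographic program $$\operatorname{lexmax}\ C\boldsymbol{x}\quad \text{s.t. } A\boldsymbol{x}=\boldsymbol{b},\ \boldsymbol{x}\geq \boldsymbol{0}$$ is feasible and lexicographically bounded from above, then there exists a primal-dual feasible basis of this program.
   Context: Notation: for a matrix $M$ and a set $X$ of column indices, $M_X$ is the restriction of $M$ to the columns indexed by $X$. Lexicographic order on $\bar{\mathbb{R}}^m$, where $\bar{\mathbb{R}}=\mathbb{R}\cup\{-\infty,+\infty\}$: $\boldsymbol{x}<_{\text{lex}}\boldsymbol{y}$ if there is $j\in\{1,\dots,m\}$ with $x_j<y_j$ and $x_h=y_h$ for all $h<j$; $\boldsymbol{x}\leqslant_{\text{lex}}\boldsymbol{y}$ if $\boldsymbol{x}<_{\text{lex}}\boldsymbol{y}$ or $\boldsymbol{x}=\boldsymbol{y}$. ''$\operatorname{lexmax} C\boldsymbol{x}$'' means that one looks for a feasible $\boldsymbol{x}^*$ with $C\boldsymbol{x}\leqslant_{\text{lex}}C\boldsymbol{x}^*$ for every feasible $\boldsymbol{x}$. The program is lexicographically bounded from above if the supremum, with respect to $\leqslant_{\text{lex}}$ in $\bar{\mathbb{R}}^m$, of $\{C\boldsymbol{x}\colon \boldsymbol{x}\text{ feasible}\}$ belongs to $\mathbb{R}^m$ (all its components are finite). A basis is a set $B$ of column indices such that $A_B$ is square and invertible; it is feasible if $A_B^{-1}\boldsymbol{b}\geq\boldsymbol{0}$.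 The reduced cost of $x_j$ with respect to a feasible basis $B$ is the $m$-dimensional vector $\overline{\boldsymbol{c}}_j=\boldsymbol{c}_j-C_BA_B^{-1}\boldsymbol{a}_j$, where $\boldsymbol{a}_j$ and $\boldsymbol{c}_j$ are the $j$-th columns of $A$ and $C$. A primal-dual feasible basis is a feasible basis $B$ such that $\overline{\boldsymbol{c}}_j\leqslant_{\text{lex}}\boldsymbol{0}$ for all $j$. *)

(* Defs.v *)
From HB Require Import structures.
From mathcomp Require Import all_boot all_order all_algebra.
From mathcomp Require Import boolp classical_sets constructive_ereal reals.

Set Implicit Arguments.
Unset Strict Implicit.
Unset Printing Implicit Defensive.

Import Order.TTheory GRing.Theory Num.Theory.
Local Open Scope classical_set_scope.
Local Open Scope ring_scope.

(* Stated over any ordered type, so that it applies both to R^m and to the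
   extended space (\bar R)^m. *)
Definition lexlt {d : Order.disp_t} {T : porderType d} {m : nat}
    (x y : 'cV[T]_m) : Prop :=
  exists j : 'I_m, (x j ord0 < y j ord0)%O /\
    forall h : 'I_m, (h < j)%N -> x h ord0 = y h ord0.

Definition lexle {d : Order.disp_t} {T : porderType d} {m : nat}
    (x y : 'cV[T]_m) : Prop :=
  lexlt x y \/ x = y.

Definition is_lexsup {d : Order.disp_t} {T : porderType d} {m : nat}
    (S : set 'cV[T]_m) (s : 'cV[T]_m) : Prop :=
  (forall y, S y -> lexle y s) /\
  (forall u, (forall y, S y -> lexle y u) -> lexle s u).

Definition feasible {R : realType} {k n : nat} (A : 'M[R]_(k, n))
    (b : 'cV[R]_k) : set 'cV[R]_n :=
  [set x | A *m x = b /\ forall j, 0 <= x j ord0].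

(* The supremum is taken in (\bar R)^m, against all extended upper bounds, and
   only then required to have finite components. *)
Definition lex_bounded_above {R : realType} {k n m : nat} (A : 'M[R]_(k, n))
    (C : 'M[R]_(m, n)) (b : 'cV[R]_k) : Prop :=
  exists s : 'cV[\bar R]_m,
    is_lexsup [set map_mx EFin (C *m x) | x in feasible A b] s /\
    forall i, s i ord0 \is a fin_num.

(* M_X, with the columns in increasing order of their indices. *)
Definition restr_cols {R : realType} {p n : nat} (M : 'M[R]_(p, n))
    (X : {set 'I_n}) : 'M[R]_(p, #|X|) :=
  colsub (fun i : 'I_#|X| => enum_val i) M.

Record basis {R : realType} {k n : nat} (A : 'M[R]_(k, n)) := Basis {
  basis_set :> {set 'I_n};
  basis_card : #|basis_set| = k;
  basis_unit :
    castmx (erefl k, basis_card) (restr_cols A basis_set) \in unitmx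
}.

(* A_B^-1, with its rows indexed by B so that it composes with C_B; the casts
   are along #|B| = k. *)
Definition basis_inv {R : realType} {k n : nat} {A : 'M[R]_(k, n)}
    (B : basis A) : 'M[R]_(#|B|, k) :=
  castmx (esym (basis_card B), erefl k)
    (invmx (castmx (erefl k, basis_card B) (restr_cols A B))).

Definition feasible_basis {R : realType} {k n : nat} {A : 'M[R]_(k, n)}
    (b : 'cV[R]_k) (B : basis A) : Prop :=
  forall i, 0 <= (basis_inv B *m b) i ord0.

Definition reduced_cost {R : realType} {k n m : nat} {A : 'M[R]_(k, n)}
    (C : 'M[R]_(m, n)) (B : basis A) (j : 'I_n) : 'cV[R]_m :=
  col j C - restr_cols C B *m basis_inv B *m col j A.

Definition primal_dual_feasible {R : realType} {k n m : nat}
    {A : 'M[R]_(k, n)} (C : 'M[R]_(m, n)) (b : 'cV[R]_k) (B : basis A) : Prop :=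
  feasible_basis b B /\ forall j, lexle (reduced_cost C B j) 0.

(* Main.v *)
Require Import Defs.
From mathcomp Require Import all_boot all_order all_algebra.
From mathcomp Require Import boolp classical_sets constructive_ereal reals.

Set Implicit Arguments.
Unset Strict Implicit.
Unset Printing Implicit Defensive.

Import Order.TTheory GRing.Theory Num.Theory.
Local Open Scope classical_set_scope.
Local Open Scope ring_scope.

(** The proof is the simplex method with a lexicographic perturbation of the
    right-hand side, with termination replaced by the choice of an optimum.

    Degeneracy is what could make a pivot fail to improve the objective, so [b]
    is replaced by the matrix [row_mx b A], whose further columns act as
    infinitesimals of decreasing size.  A solution is now a matrix [X] with
    [A *m X = row_mx b A] and lexicographically nonnegative rows.  This
    perturbation has two merits.  A feasible [x] at once gives the solution
    [row_mx x 1%:M].  And since [A] has full row rank, so has [row_mx b A]; hence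
    a solution supported on at most [k] columns is supported on exactly [k]
    columns, which form a basis, and none of its [k] rows vanishes
    ([basis_of_support]).  Neither the extension of independent columns to a
    basis nor the invertibility of a basis after a pivot needs an argument of
    its own.

    Everything rests on one move: given [v] in the kernel of [A] with a positive
    entry, the ratio test subtracts from [X] the largest multiple of [v] that
    keeps the rows nonnegative, and kills a row of [X] ([lexfeasible_pivot]).
    Applied to a dependency among the columns of a minimal support, it shows that
    this support has at most [k] elements ([exists_lexfeasible_basic]).

    The sets of at most [k] columns are finitely many and each carries at most
    one solution, so one of them maximizes [C *m X] lexicographically
    ([exists_optimal_basic]).  If a reduced cost were lexicographically positive
    there, the corresponding direction [v] would either have a positive entry,
    and the same move would improve [C *m X], strictly because the step is a
    nonzero row; or [- v] would be a ray of the feasible set along which the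
    objective increases, against boundedness ([no_improving_ray]). *)

(** * Lexicographic order *)

Lemma exists_maximal (T : finType) (P : T -> Prop) (r : T -> T -> Prop) :
  (forall x, ~ r x x) -> (forall x y z, r x y -> r y z -> r x z) ->
  (exists x, P x) -> exists2 x, P x & forall y, P y -> ~ r x y.
Proof.
move=> rI rT [x0 Px0].
have Px0' : `[< P x0 >] by apply/asboolP.
(* A point with the most predecessors has no successor: a successor would
   inherit all of them and gain the point itself. *)
pose below x := #|[pred y | `[< r y x >]]|.
case: (@arg_maxnP T x0 (fun x => `[< P x >]) below Px0') => x /asboolP Px xmax.
exists x => // y Py rxy.
have /asboolP/xmax : P y by [].
apply/negP; rewrite -ltnNge; apply/proper_card/properP; split.
  apply/fintype.subsetP => z; rewrite !inE => rzx.
  exact: rT rzx rxy.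
exists x; first by rewrite inE.
by rewrite inE; apply/asboolPn/rI.
Qed.

Lemma lexle_coord (d : Order.disp_t) (T : porderType d) (m : nat)
    (x y : 'cV[T]_m) (i : 'I_m) :
  lexle x y -> (forall h : 'I_m, (h < i)%N -> x h ord0 = y h ord0) ->
  (x i ord0 <= y i ord0)%O.
Proof.
move=> [[j [xyj eqj]]|->//] eqi.
case: (ltngtP i j) => [/eqj->//|/eqi xyE|/val_inj->]; last exact: ltW.
by rewrite xyE ltxx in xyj.
Qed.

(** Positivity for the lexicographic order on vectors whose entries lie in a
    group ordered by the cone [pos].  The abstract cone lets the construction be
    iterated: real entries give the order on rows, and rows as entries give the
    order on matrices. *)
Definition lexpos (V : zmodType) (pos : V -> Prop) (m : nat) (f : 'I_m -> V) :=
  exists2 j, pos (f j) & forall h : 'I_m, (h < j)%N -> f h = 0.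

Lemma lexposD (V : zmodType) (pos : V -> Prop) (m : nat) (f g : 'I_m -> V) :
  (forall u v, pos u -> pos v -> pos (u + v)) ->
  lexpos pos f -> lexpos pos g -> lexpos pos (fun i => f i + g i).
Proof.
move=> posD [i fi f0] [j gj g0].
case: (ltngtP i j) => [ij|ji|/val_inj eij].
- exists i; first by rewrite g0 // addr0.
  by move=> h hi; rewrite f0 // g0 ?addr0 //; apply: ltn_trans ij.
- exists j; first by rewrite f0 // add0r.
  by move=> h hj; rewrite g0 // f0 ?addr0 //; apply: ltn_trans ji.
- subst j; exists i; first exact: posD.
  by move=> h hi; rewrite f0 // g0 // addr0.
Qed.

Lemma lexpos_total (V : zmodType) (pos : V -> Prop) (m : nat) (f : 'I_m -> V) :
  (forall u, u != 0 -> pos u \/ pos (- u)) ->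
  (forall i, f i = 0) \/ lexpos pos f \/ lexpos pos (fun i => - f i).
Proof.
move=> posT.
have [/existsP[i0 fi0]|/existsPn f0] := boolP [exists i, f i != 0]; last first.
  by left=> i; apply/eqP/negbNE/f0.
right; case: (@arg_minnP _ i0 (fun i => f i != 0) val fi0) => i fi imin.
have f0 (h : 'I_m) : (h < i)%N -> f h = 0.
  by move=> hi; apply/eqP; apply: contraTT hi => /imin; rewrite -leqNgt.
case: (posT _ fi) => posi; [left|right]; exists i => // h /f0 ->.
by rewrite oppr0.
Qed.

Section PositiveRows.

Variables (R : realType) (p : nat).
Implicit Types (u v : 'rV[R]_p) (a : R).

Definition rowpos v := lexpos (fun a : R => 0 < a) (v ord0).
Definition rownneg v := v = 0 \/ rowpos v.

Lemma rowposD u v : rowpos u -> rowpos v -> rowpos (u + v).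
Proof.
move=> pu pv; have [|j vj v0] := lexposD _ pu pv; first by move=> *; apply: addr_gt0.
by exists j => [|h /v0]; rewrite mxE.
Qed.

Lemma rowposZ a v : 0 < a -> rowpos v -> rowpos (a *: v).
Proof.
move=> a0 [j vj v0]; exists j; first by rewrite mxE mulr_gt0.
by move=> h /v0; rewrite mxE => ->; rewrite mulr0.
Qed.

Lemma rowpos0 : ~ rowpos 0.
Proof. by case=> j; rewrite mxE ltxx. Qed.

Lemma real_pos_total a : a != 0 -> 0 < a \/ 0 < - a.
Proof. by rewrite oppr_gt0 => /lt_total/orP[]; [right|left]. Qed.

Lemma rowpos_total v : rownneg v \/ rowpos (- v).
Proof.
case: (lexpos_total (v ord0) real_pos_total) => [v0|[pv|nv]].
- by left; left; apply/rowP => i; rewrite v0 mxE.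
- by left; right.
- by right; case: nv => j vj v0; exists j => [|h /v0]; rewrite mxE.
Qed.

Lemma rownnegD u v : rownneg u -> rownneg v -> rownneg (u + v).
Proof.
case=> [->|pu]; first by rewrite add0r.
by case=> [->|pv]; right; rewrite ?addr0 //; apply: rowposD.
Qed.

Lemma rownnegZ a v : 0 <= a -> rownneg v -> rownneg (a *: v).
Proof.
rewrite le0r => /orP[/eqP->|a0]; first by left; rewrite scale0r.
by case=> [->|pv]; [left; rewrite scaler0 | right; apply: rowposZ].
Qed.

(** Rows are compared before columns: the objectives keep their priorities, and
    the perturbation only separates solutions within one objective. *)
Definition mxpos m (M : 'M[R]_(m, p)) := lexpos rowpos (fun i => row i M).

Lemma mxposD m (M N : 'M[R]_(m, p)) : mxpos M -> mxpos N -> mxpos (M + N).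
Proof.
move=> pM pN; have [i ri r0] := lexposD rowposD pM pN.
by exists i => [|h /r0]; rewrite linearD.
Qed.

Lemma mxpos0 m : ~ mxpos (0 : 'M[R]_(m, p)).
Proof. by case=> i; rewrite row0 => /rowpos0. Qed.

(** A reduced cost times a step length is the gain of a pivot.  The leading entry
    of the product is the product of the two leading entries. *)
Lemma mxpos_outer m (c : 'cV[R]_m) v :
  lexpos (fun a : R => 0 < a) (c^~ ord0) -> rowpos v -> mxpos (c *m v).
Proof.
have rowE i : row i (c *m v) = c i ord0 *: v.
  by apply/rowP => j; rewrite !mxE big_ord1.
move=> [i ci c0] pv; exists i; first by rewrite rowE; apply: rowposZ.
by move=> h /c0; rewrite rowE => ->; rewrite scale0r.
Qed.

End PositiveRows.

(** * The ratio test *)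

(** The step is the lexicographically smallest of the ratios [X_i / v_i] over
    [v_i > 0]; rows with [v_i <= 0] can only grow. *)
Lemma ratio_test (R : realType) (n p : nat) (X : 'M[R]_(n, p)) (v : 'cV[R]_n) :
  (forall i, rownneg (row i X)) -> (exists i, 0 < v i ord0) ->
  exists2 l, 0 < v l ord0 &
    forall i, rownneg (row i X - v i ord0 *: ((v l ord0)^-1 *: row l X)).
Proof.
move=> X0 v0; pose ratio i := (v i ord0)^-1 *: row i X.
have [||l vl lmin] := @exists_maximal _ (fun i => 0 < v i ord0)
  (fun i j => rowpos (ratio i - ratio j)) _ _ v0.
- by move=> i; rewrite subrr; apply: rowpos0.
- move=> i j h ij jh; have := rowposD ij jh.
  by rewrite addrA subrK.
exists l => // i; have [vi|vi] := ltP 0 (v i ord0).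
  have -> : row i X - v i ord0 *: ratio l = v i ord0 *: (ratio i - ratio l).
    by rewrite scalerBr [_ *: ratio i]scalerA divff ?scale1r // gt_eqF.
  apply: rownnegZ (ltW vi) _; case: (rowpos_total (ratio i - ratio l)) => //.
  by rewrite opprB => /(lmin _ vi).
rewrite -scaleNr; apply: rownnegD => //.
apply: rownnegZ; first by rewrite oppr_ge0.
by apply: rownnegZ => //; rewrite invr_ge0 ltW.
Qed.

(** * Bases and supports *)

Section Bases.

Variables (R : realType) (k n : nat) (A : 'M[R]_(k, n)).

Definition supported q (X : 'M[R]_(n, q)) (S : {set 'I_n}) :=
  forall i, i \notin S -> row i X = 0.

Definition restr_rows q (X : 'M[R]_(n, q)) (S : {set 'I_n}) : 'M[R]_(#|S|, q) :=
  rowsub (fun i : 'I_#|S| => enum_val i) X.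

Definition extend_rows q (S : {set 'I_n}) (Y : 'M[R]_(#|S|, q)) : 'M[R]_(n, q) :=
  \matrix_(i, j) \sum_(h < #|S| | enum_val h == i) Y h j.

Lemma restr_extend q (S : {set 'I_n}) (Y : 'M[R]_(#|S|, q)) :
  restr_rows (extend_rows Y) S = Y.
Proof.
apply/matrixP => i j; rewrite !mxE (big_pred1 i) // => h.
by rewrite /= (inj_eq enum_val_inj).
Qed.

Lemma supported_extend q (S : {set 'I_n}) (Y : 'M[R]_(#|S|, q)) :
  supported (extend_rows Y) S.
Proof.
move=> i iS; apply/rowP => j; rewrite !mxE big1 // => h /eqP hi.
by rewrite -hi enum_valP in iS.
Qed.

Lemma mul_restr p q (D : 'M[R]_(p, n)) (X : 'M[R]_(n, q)) (S : {set 'I_n}) :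
  supported X S -> restr_cols D S *m restr_rows X S = D *m X.
Proof.
move=> XS; apply/matrixP => i j; rewrite !mxE.
rewrite (bigID (mem S)) /= [X in _ + X]big1 ?addr0.
  by rewrite [RHS]big_enum_val; apply: eq_bigr => h _; rewrite !mxE.
by move=> h /XS/rowP/(_ j); rewrite !mxE => ->; rewrite mulr0.
Qed.

Lemma supported_restr0 q (X : 'M[R]_(n, q)) (S : {set 'I_n}) :
  supported X S -> restr_rows X S = 0 -> X = 0.
Proof.
move=> XS X0; apply/row_matrixP => i; rewrite row0.
have [iS|/XS//] := boolP (i \in S); apply/rowP => j; rewrite !mxE.
move/matrixP/(_ (enum_rank_in iS i) j): X0.
by rewrite !mxE enum_rankK_in.
Qed.

Lemma mul_restr_basis_inv (B : basis A) : restr_cols A B *m basis_inv B = 1%:M.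
Proof.
case: B => S e; rewrite /basis_inv /=; move: A; case: _ / e => D uD /=.
by rewrite !castmx_id mulmxV // -[restr_cols _ _](castmx_id (erefl, erefl)).
Qed.

Lemma mul_basis_inv_restr (B : basis A) : basis_inv B *m restr_cols A B = 1%:M.
Proof.
case: B => S e; rewrite /basis_inv /=; move: A; case: _ / e => D uD /=.
by rewrite !castmx_id mulVmx // -[restr_cols _ _](castmx_id (erefl, erefl)).
Qed.

(** The rank does the work: [A *m X] is the product of the columns of [A] in [S]
    by the rows of [X] in [S], so these columns have rank [k], which forces [S] to
    have [k] elements and the square submatrix to be invertible. *)
Lemma basis_of_support q (X : 'M[R]_(n, q)) (S : {set 'I_n}) :
  row_free (A *m X) -> supported X S -> (#|S| <= k)%N ->
  exists B : basis A, B = S :> {set 'I_n}.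
Proof.
move=> fAX XS Sk.
have rk : (k <= \rank (restr_cols A S))%N.
  by rewrite -{1}(eqP fAX) -(mul_restr A XS) mxrankM_maxl.
have cS : #|S| = k by apply/eqP; rewrite eqn_leq Sk (leq_trans rk) ?rank_leq_col.
suff uS : castmx (erefl k, cS) (restr_cols A S) \in unitmx by exists (Basis uS).
have castE q' (e : #|S| = q') (M : 'M[R]_(k, #|S|)) :
  row_free (castmx (erefl k, e) M) = row_free M.
  by case: _ / e; rewrite castmx_id.
rewrite -row_free_unit castE /row_free eqn_leq rk andbT.
exact: rank_leq_row.
Qed.

Lemma basis_supported_inj q (X Y : 'M[R]_(n, q)) (B : basis A) :
  supported X B -> supported Y B -> A *m X = A *m Y -> X = Y.
Proof.
move=> XB YB AXY; apply/eqP; rewrite -subr_eq0; apply/eqP.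
have DB : supported (X - Y) B.
  by move=> i iB; rewrite linearB /= XB // YB // subrr.
apply: (supported_restr0 DB).
rewrite -[LHS]mul1mx -(mul_basis_inv_restr B) -mulmxA mul_restr //.
by rewrite mulmxBr AXY subrr mulmx0.
Qed.

Lemma dependent_columns (S : {set 'I_n}) : (k < #|S|)%N ->
  exists v : 'cV[R]_n,
    [/\ supported v S, A *m v = 0 & exists i, 0 < v i ord0].
Proof.
move=> kS; pose K := kermx (restr_cols A S)^T.
have /rowV0Pn[w wK w0] : K != 0.
  rewrite -mxrank_eq0 mxrank_ker mxrank_tr subn_eq0 -ltnNge.
  exact: leq_ltn_trans (rank_leq_row _) kS.
pose v := extend_rows w^T.
have Av : A *m v = 0.
  rewrite -(mul_restr A (@supported_extend _ S w^T)) restr_extend.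
  by rewrite -[restr_cols A S]trmxK -trmx_mul (sub_kermxP wK) trmx0.
have [i vi] : exists i, v i ord0 != 0.
  apply/existsP; apply: contra_neqT w0 => /existsPn v0.
  rewrite -[w]trmxK -[w^T](restr_extend) -/v.
  suff -> : v = 0 by apply/matrixP => x y; rewrite !mxE.
  by apply/colP => i; rewrite [RHS]mxE; apply/eqP/negbNE/v0.
case: (real_pos_total vi) => pvi.
  by exists v; split=> //; [exact: supported_extend | exists i].
exists (- v); split; last by exists i; rewrite mxE.
  by move=> h hS; rewrite linearN /= supported_extend // oppr0.
by rewrite mulmxN Av oppr0.
Qed.

End Bases.

(** * Boundedness *)

(** It is not enough that the objective grows along the ray, as the ray may leave
    the objectives before [i] fixed at values below those of [s], where [i] is
    the leading index of [C *m u].  But some feasible point attains [s] in all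
    these coordinates: otherwise [s] truncated by [-oo] from [i] on would be a
    smaller upper bound.  From that point the ray overtakes [s] in
    coordinate [i]. *)
Lemma no_improving_ray (R : realType) (k n m : nat) (A : 'M[R]_(k, n))
    (C : 'M[R]_(m, n)) (b : 'cV[R]_k) (u : 'cV[R]_n) :
  lex_bounded_above A C b -> A *m u = 0 -> (forall j, 0 <= u j ord0) ->
  ~ lexpos (fun a : R => 0 < a) ((C *m u)^~ ord0).
Proof.
move=> [s [[sub slub] sfin]] Au u0 [i ui uh].
pose cut : 'cV[\bar R]_m := \col_h (if (h < i)%N then s h ord0 else -oo%E).
have [x [Ax x0] xs] : exists2 x, feasible A b x &
    forall h : 'I_m, (h < i)%N -> ((C *m x) h ord0)%:E = s h ord0.
  apply: contrapT => nox.
  have : lexle s cut.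
    apply: slub => _ [x fx <-].
    case: (sub _ (ex_intro2 _ _ x fx erefl)) => [[j [sj jE]]|xE]; last first.
      by case: nox; exists x => // h _; rewrite -xE !mxE.
    have [ij|ji] := leqP i j.
      case: nox; exists x => // h hi.
      by rewrite -(jE _ (leq_trans hi ij)) !mxE.
    left; exists j; split; first by rewrite [ltRHS]mxE ji.
    by move=> h hj; rewrite jE // [RHS]mxE (ltn_trans hj ji).
  move/(@lexle_coord _ _ _ _ _ i); rewrite mxE ltnn leeNy_eq.
  move=> /(_ _)/eqP si; have := sfin i; rewrite si // => h hi.
  by rewrite mxE hi.
(* The step that takes objective i at least 1 above its value in s. *)
pose t := (`|fine (s i ord0) - (C *m x) i ord0| + 1) / (C *m u) i ord0.
have t0 : 0 <= t by rewrite divr_ge0 ?addr_ge0 // ltW.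
have fy : feasible A b (x + t *: u).
  split=> [|j]; first by rewrite mulmxDr -scalemxAr Au scaler0 addr0.
  by rewrite !mxE addr_ge0 // mulr_ge0.
have CyE h : (C *m (x + t *: u)) h ord0 = (C *m x) h ord0 + t * (C *m u) h ord0.
  by rewrite mulmxDr -scalemxAr !mxE.
have := lexle_coord (i := i) (sub _ (ex_intro2 _ _ _ fy erefl)).
rewrite [X in (X <= _)%O]mxE CyE -(fineK (sfin i)) lee_fin => si.
suff /si : forall h : 'I_m, (h < i)%N ->
    (map_mx EFin (C *m (x + t *: u))) h ord0 = s h ord0; last first.
  by move=> h hi; rewrite mxE CyE uh // mulr0 addr0 xs.
rewrite divfK ?gt_eqF // -lerBrDl.
by apply/negP; rewrite -ltNge; apply: le_lt_trans (ler_norm _) _; rewrite ltrDl.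
Qed.

(** * The lexicographic simplex method *)

Section LexicographicSimplex.

Variables (R : realType) (k n m : nat) (A : 'M[R]_(k, n)) (C : 'M[R]_(m, n)).
Variable b : 'cV[R]_k.

(** Feasibility for the perturbed right-hand side: column [0] of [X] solves the
    original system, and the other [n] columns are the infinitesimal terms. *)
Definition lexfeasible (S : {set 'I_n}) (X : 'M[R]_(n, 1 + n)) :=
  [/\ A *m X = row_mx b A, forall i, rownneg (row i X) & supported X S].

Lemma row_free_perturbed : row_free A -> row_free (row_mx b A).
Proof.
move=> fA; rewrite /row_free eqn_leq rank_leq_row -{1}(eqP fA).
have {1}-> : A = row_mx b A *m col_mx 0 1%:M.
  by rewrite mul_row_col mulmx0 add0r mulmx1.
exact: mxrankM_maxl.
Qed.

(** The identity block makes every row positive, even where [x] vanishes. *)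
Lemma lexfeasible_of_feasible x : feasible A b x ->
  lexfeasible [set: 'I_n]%SET (row_mx x 1%:M).
Proof.
move=> [Ax x0]; split=> [|i|i]; last by rewrite inE.
  by rewrite mul_mx_row Ax mulmx1.
right; have := x0 i; rewrite le_eqVlt => /orP[/eqP xi|xi]; last first.
  by exists (lshift n ord0) => //; rewrite mxE row_mxEl.
exists (rshift 1 i) => [|h]; first by rewrite mxE row_mxEr mxE eqxx ltr01.
rewrite mxE; case: (split_ordP h) => h' -> hi.
  by rewrite row_mxEl ord1 -xi.
rewrite row_mxEr mxE; case: eqP => // eih.
by move: hi; rewrite eih ltnn.
Qed.

(** The set [T] is left free because the move has two uses: with [T = S] it
    shrinks a dependent support, and with [T] a basis and one entering column it
    is a simplex pivot. *)
Lemma lexfeasible_pivot S X v : lexfeasible S X ->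
  A *m v = 0 -> (exists i, 0 < v i ord0) ->
  exists2 l, 0 < v l ord0 &
    forall T : {set 'I_n}, S \subset T -> supported v T ->
    lexfeasible (T :\ l) (X - v *m ((v l ord0)^-1 *: row l X)).
Proof.
move=> [AX X0 XS] Av v0; have [l vl lX] := ratio_test X0 v0.
exists l => // T ST vT; set t := _ *: _.
have rowE i : row i (X - v *m t) = row i X - v i ord0 *: t.
  by apply/rowP => j; rewrite !mxE big_ord1 !mxE.
split=> [|i|i]; first by rewrite mulmxBr mulmxA Av mul0mx subr0.
  by rewrite rowE; apply: lX.
rewrite rowE in_setD1 negb_and negbK => /orP[/eqP->|iT].
  by rewrite scalerA divff ?scale1r ?subrr // gt_eqF.
rewrite XS; last by apply: contraNN iT => /(fintype.subsetP ST).
by move/rowP/(_ ord0): (vT i iT); rewrite !mxE => ->; rewrite scale0r subr0.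
Qed.

(** Carathéodory's argument: a support of more than [k] columns is dependent, and
    moving along a dependency makes it smaller. *)
Lemma exists_lexfeasible_basic x : feasible A b x ->
  exists2 S : {set 'I_n}, (#|S| <= k)%N & exists X, lexfeasible S X.
Proof.
move=> fx; pose P S := `[< exists X, lexfeasible S X >].
have [|S /minsetP[/asboolP[X fX] Smin]] := @ex_minset _ P.
  exists [set: 'I_n]%SET; apply/asboolP; eexists.
  exact: lexfeasible_of_feasible fx.
exists S; last by exists X.
rewrite leqNgt; apply/negP => /(dependent_columns A)[v [vS Av v0]].
have [l vl /(_ S (subxx S) vS) fX'] := lexfeasible_pivot fX Av v0.
have lS : l \in S.
  apply: contraTT vl => /vS/rowP/(_ ord0); rewrite !mxE => ->.
  by rewrite ltxx.
suff SE : S :\ l = S by move: lS; rewrite -SE setD11.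
by apply: Smin; [apply/asboolP; eexists; exact: fX' | exact: subD1set].
Qed.

(** Solutions are infinitely many, so the maximum is taken over supports; this is
    sound because a support of at most [k] columns determines the solution. *)
Lemma exists_optimal_basic x : row_free A -> feasible A b x ->
  exists (B : basis A) (X : 'M[R]_(n, 1 + n)), lexfeasible B X /\
    forall (T : {set 'I_n}) (Y : 'M[R]_(n, 1 + n)), (#|T| <= k)%N ->
      lexfeasible T Y -> ~ mxpos (C *m Y - C *m X).
Proof.
move=> /row_free_perturbed fA /exists_lexfeasible_basic exS.
have uniqX (S : {set 'I_n}) X Y :
  (#|S| <= k)%N -> lexfeasible S X -> lexfeasible S Y -> X = Y.
  move=> Sk [AX _ XS] [AY _ YS].
  have [|B BS] := @basis_of_support _ _ _ A _ X S _ XS Sk; first by rewrite AX.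
  by apply: (@basis_supported_inj _ _ _ A _ _ _ B); rewrite ?BS ?AX ?AY.
pose basic (S : {set 'I_n}) := (#|S| <= k)%N /\ exists X, lexfeasible S X.
pose better S T := [/\ basic S, basic T & forall X Y,
  lexfeasible S X -> lexfeasible T Y -> mxpos (C *m Y - C *m X)].
have [|||S [Sk [X fX]] Smax] := @exists_maximal _ basic better.
- move=> S [[_ [X fX]] _ /(_ _ _ fX fX)].
  by rewrite subrr; apply: mxpos0.
- move=> S T U [bS bT ST] [_ bU TU]; split=> // X Z fX fZ.
  have [_ [Y fY]] := bT; have := mxposD (TU _ _ fY fZ) (ST _ _ fX fY).
  by rewrite addrA subrK.
- by have [S Sk fS] := exS; exists S.
have [AX _ XS] := fX.
have [|B BS] := @basis_of_support _ _ _ A _ X S _ XS Sk; first by rewrite AX.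
exists B, X; rewrite BS; split=> // T Y Tk fY CXY.
apply: (Smax T); first by split=> //; exists Y.
split=> [||X' Y' fX' fY']; [by split=> //; exists X | by split=> //; exists Y |].
by rewrite (uniqX _ _ _ Sk fX' fX) (uniqX _ _ _ Tk fY' fY).
Qed.

Lemma feasible_basis_of_lexfeasible (B : basis A) X :
  lexfeasible B X -> feasible_basis b B.
Proof.
move=> [AX X0 XB] i.
have <- : restr_rows (lsubmx X) B = basis_inv B *m b.
  have XB' : supported (lsubmx X) B.
    move=> h /XB/rowP Xh; apply/rowP => i'.
    by have := Xh (lshift n i'); rewrite !mxE.
  have <- : A *m lsubmx X = b by rewrite mulmx_lsub AX row_mxKl.
  by rewrite -(mul_restr A XB') mulmxA mul_basis_inv_restr mul1mx.
rewrite !mxE; case: (X0 (enum_val i)) => [/rowP/(_ (lshift n ord0))|[j Xj Xh]].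
  by rewrite !mxE => ->.
have [j0|j0] := posnP j; last first.
  by have := Xh (lshift n ord0) j0; rewrite mxE => ->.
by move: Xj; rewrite mxE (_ : j = lshift n ord0) => [/ltW//|]; apply: val_inj.
Qed.

(** The entering column [j] gets coefficient [-1] in this kernel vector, and the
    basic columns compensate for it.  Moving against [v] raises [x_j], hence the
    sign in front of the reduced cost. *)
Lemma basic_direction (B : basis A) j : exists v : 'cV[R]_n,
  [/\ A *m v = 0, C *m v = - reduced_cost C B j, supported v (j |: B) &
    forall i, i \notin (B : {set 'I_n}) -> v i ord0 <= 0].
Proof.
pose y := basis_inv B *m col j A; pose d := extend_rows y.
have dB : supported d B by apply: supported_extend.
have dE i : i \notin (B : {set 'I_n}) -> d i ord0 = 0.
  by move=> /dB/rowP/(_ ord0); rewrite !mxE.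
exists (d - delta_mx j ord0); split=> [|||i iB].
- rewrite mulmxBr -colE -(mul_restr A dB) restr_extend mulmxA mul_restr_basis_inv.
  by rewrite mul1mx subrr.
- by rewrite mulmxBr -colE -(mul_restr C dB) restr_extend opprB mulmxA.
- move=> i; rewrite !inE negb_or => /andP[ij iB].
  rewrite linearB /= dB // sub0r; apply/rowP => h.
  by rewrite ord1 !mxE (negPf ij) oppr0.
by rewrite mxE dE // add0r !mxE oppr_le0 ler0n.
Qed.

Lemma optimal_basic_reduced_cost (B : basis A) X j :
  row_free A -> lex_bounded_above A C b -> lexfeasible B X ->
  (forall (T : {set 'I_n}) (Y : 'M[R]_(n, 1 + n)), (#|T| <= k)%N ->
    lexfeasible T Y -> ~ mxpos (C *m Y - C *m X)) ->
  lexle (reduced_cost C B j) 0.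
Proof.
move=> /row_free_perturbed fA bnd fX Xmax; set c := reduced_cost C B j.
have [c0|[cpos|[i ci ch]]] := lexpos_total (c^~ ord0) (@real_pos_total R).
- by right; apply/colP => i; rewrite c0 mxE.
- exfalso; have [v [Av Cv vjB vB]] := basic_direction B j.
  have [v0|nv] := pselect (exists i, 0 < v i ord0); last first.
    apply: (no_improving_ray (u := - v) bnd); last by rewrite mulmxN Cv opprK.
      by rewrite mulmxN Av oppr0.
    move=> i; rewrite mxE oppr_ge0 leNgt; apply/negP => vi.
    by apply: nv; exists i.
  have [l vl fY] := lexfeasible_pivot fX Av v0.
  have {fY} fY := fY _ (finset.subsetUr _ _) vjB.
  have lB : l \in (B : {set 'I_n}).
    by apply: contraTT vl => /vB; rewrite -leNgt.
  have kB := basis_card B.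
  apply: Xmax fY _.
    have := cardsD1 l (j |: B); rewrite finset.in_setU lB orbT cardsU1 kB => e.
    by rewrite -(leq_add2l 1) -e leq_add2r leq_b1.
  rewrite mulmxBr mulmxA Cv mulNmx opprK addrAC subrr add0r.
  apply: mxpos_outer => //; apply: rowposZ; first by rewrite invr_gt0.
  (* A vanishing row l would leave a solution supported on k - 1 columns. *)
  have [AX X0 XB] := fX; case: (X0 l) => // Xl; exfalso.
  have XBl : supported X (B :\ l).
    by move=> i; rewrite !inE negb_and negbK => /orP[/eqP->|/XB].
  have Blk : (#|B :\ l| < k)%N.
    by have := cardsD1 l B; rewrite lB kB => /esym/eq_leq.
  have [|B' B'E] := @basis_of_support _ _ _ A _ X _ _ XBl (ltnW Blk).
    by rewrite AX.
  by have := basis_card B'; rewrite B'E => B'k; rewrite B'k ltnn in Blk.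
left; exists i; rewrite [ltRHS]mxE; split; first by rewrite -oppr_gt0.
by move=> h /ch/eqP; rewrite oppr_eq0 [RHS]mxE => /eqP.
Qed.

End LexicographicSimplex.

Theorem corollary1 (R : realType) (k n m : nat) (A : 'M[R]_(k, n))
    (C : 'M[R]_(m, n)) (b : 'cV[R]_k)
    (A_full : row_free A)
    (feas : feasible A b !=set0)
    (bnd : lex_bounded_above A C b) :
  exists B : basis A, primal_dual_feasible C b B.
Proof.
have [x fx] := feas.
have [B [X [fX Xmax]]] := exists_optimal_basic C A_full fx.
exists B; split; first exact: feasible_basis_of_lexfeasible fX.
by move=> j; apply: optimal_basic_reduced_cost fX Xmax.
Qed.
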